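(* With the notation of the context, let $j\colon M\hookrightarrow X=T_M$ be the inclusion of the zero-section, which in local co-ordinates is the locus $\theta_1=\dots=\theta_n=0$. Let $\tau$ be the $\tau$-function associated to local symplectic potentials $\Theta_0,\Theta_1,\Theta_\infty$. Then the restriction $\tau|_M=\tau\circ j$ satisfies $$d\log(\tau|_M)=\Theta_0-j^*q_1^*(\Theta_1),$$ so that $\log(\tau|_M)$ is the generating function for the symplectic map $q_1\circ j\colon M\to Z_1$ with respect to the symplectic potentials $\Theta_0$ on $M=Z_0$ and $\Theta_1$ on $Z_1$.
   Context: Everything is holomorphic. A period structure on a complex manifold $M$ of dimension $n$ is an atlas of distinguished charts whose transition functions are linear maps in $GL_n(\mathbb{Z})$; co-ordinates $(z_1,\dots,z_n)$ of a distinguished chart are called integral linear. They induce local co-ordinates $(z_i,\theta_j)$ on the total space $\pi\colon X=T_M\to M$ by writing tangent vectors as $\sum_i\theta_i\,\partial/\partial z_i$. A Joyce structure on $M$ consists of a period structure, a holomorphic symplectic form $\omega=\frac12\sum_{p,q}\omega_{pq}\,dz_p\wedge dz_q$, with $(\omega_{pq})$ a constant matrix in integral linear co-ordinates, whose inverse matrix $(\eta_{pq})$ has entries in $2\pi i\,\mathbb{Z}$, and a non-linear connection $h\colon\pi^*(T_M)\to T_X$ on $\pi$ of the following form. Set $v_i=v(\partial/\partial z_i)=\partial/\partial\theta_i$ (the vertical lift) and $$h_i=h\left(\frac{\partial}{\partial z_i}\right)=\frac{\partial}{\partial z_i}+\sum_{p,q}\eta_{pq}\frac{\partial^2W}{\partial\theta_i\partial\theta_p}\frac{\partial}{\partial\theta_q},$$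 where $W=W(z,\theta)$ is a locally-defined function with $W(z,0)=0=\frac{\partial W}{\partial\theta_i}(z,0)$, satisfying $$\frac{\partial^2W}{\partial\theta_i\partial z_j}-\frac{\partial^2W}{\partial\theta_j\partial z_i}=\sum_{p,q}\eta_{pq}\frac{\partial^2W}{\partial\theta_i\partial\theta_p}\frac{\partial^2W}{\partial\theta_j\partial\theta_q},$$ together with the symmetries: the functions $\frac{\partial^2W}{\partial\theta_i\partial\theta_j}$ are invariant under $\theta\mapsto\theta+2\pi i k$ for $k\in\mathbb{Z}^n$; $W(\lambda z,\theta)=\lambda^{-1}W(z,\theta)$ for $\lambda\in\mathbb{C}^*$; and $W(z,-\theta)=-W(z,\theta)$. The connections $h_\epsilon=h+\epsilon^{-1}v$, for $\epsilon\in\mathbb{C}^*\cup\{\infty\}$, are then flat. The Euler vector field on $X$ is $E=\sum_i z_i\,\partial/\partial z_i$ (in the co-ordinates $(z_i,\theta_j)$); the same formula defines a vector field on $M$, also denoted $E$. There are closed 2-forms on $X$: $$\Omega_+=\tfrac12\sum\omega_{pq}\,dz_p\wedge dz_q,\qquad 2i\,\Omega_I=-\sum\omega_{pq}\,dz_p\wedge d\theta_q,$$ $$\Omega_-=\tfrac12\sum\omega_{pq}\,d\theta_p\wedge d\theta_q+\sum\frac{\partial^2W}{\partial\theta_p\partial\theta_q}\,d\theta_p\wedge dz_q+\sum\frac{\partial^2W}{\partial z_p\partial\theta_q}\,dz_p\wedge dz_q.$$ For $\epsilon\in\mathbb{C}^*\cup\{\infty\}$ the twistor fibre $Z_\epsilon$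 is the space of leaves of the foliation $\mathrm{im}(h_\epsilon)\subset T_X$, with quotient map $q_\epsilon\colon X\to Z_\epsilon$; also $Z_0=M$ and $q_0=\pi$. These leaf spaces are treated as complex manifolds (equivalently, all objects on $Z_\epsilon$ may be viewed as objects on $X$ descending along the foliation). There are symplectic forms $\Omega_\epsilon$ on $Z_\epsilon$ with $q_\epsilon^*(\Omega_\epsilon)=\epsilon^{-2}\Omega_++2i\epsilon^{-1}\Omega_I+\Omega_-$ for $\epsilon\in\mathbb{C}^*$, $q_\infty^*(\Omega_\infty)=\Omega_-$, and $\Omega_0=\omega$, $q_0^*(\Omega_0)=\Omega_+$. The vector field $E$ induces vector fields, also denoted $E$, on $Z_0$ and $Z_\infty$. Write $i_E$ for contraction and $\mathcal{L}_E$ for the Lie derivative. Set $\Theta_I=i_E(\Omega_I)$, so $2i\Theta_I=-\sum\omega_{pq}z_p\,d\theta_q$ and $d\Theta_I=\Omega_I$. Definition of the $\tau$-function: choose locally-defined 1-forms $\Theta_0$ on $Z_0$ with $d\Theta_0=\Omega_0$, $\mathcal{L}_E(\Theta_0)=2\Theta_0$; $\Theta_1$ on $Z_1$ with $d\Theta_1=\Omega_1$; $\Theta_\infty$ on $Z_\infty$ with $d\Theta_\infty=\Omega_\infty$, $\mathcal{L}_E(\Theta_\infty)=0$. The corresponding $\tau$-function is the locally-defined function on $X$, unique up to multiplication by constants, satisfying $$d\log(\tau)=q_0^*(\Theta_0)+2i\Theta_I+q_\infty^*(\Theta_\infty)-q_1^*(\Theta_1).$$ Generating function: if $\phi\colon(S,\Omega_S)\to(S',\Omega_{S'})$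 satisfies $\phi^*\Omega_{S'}=\Omega_S$ and $\Theta,\Theta'$ are symplectic potentials for $\Omega_S,\Omega_{S'}$, the generating function of $\phi$ with respect to them is a locally-defined function $K$ with $dK=\Theta-\phi^*\Theta'$. All statements are local, on the domains where the chosen potentials are defined. *)

(* Defs.v *)
From HB Require Import structures.
From mathcomp Require Import all_boot all_order all_algebra.
From mathcomp Require Import all_classical all_reals all_analysis.
From mathcomp Require Import complex.

Set Implicit Arguments.
Unset Strict Implicit.
Unset Printing Implicit Defensive.

Import Order.TTheory GRing.Theory Num.Theory.
Import numFieldNormedType.Exports.

Local Open Scope classical_set_scope.
Local Open Scope ring_scope.

Lemma near_eq_diff (K : numFieldType) (V W : normedModType K) (f g : V -> W)
    (x : V) : (\forall y \near x, f y = g y) -> differentiable f x ->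
  differentiable g x /\ 'd g x = 'd f x :> (V -> W).
Proof.
move=> fg df.
have gE : g \o shift x = cst (g x) + 'd f x +o_ 0 id.
  apply/eqaddoP => e e0.
  have [_ /eqaddoP/(_ e e0)] := (iffLR (diff_locallyP _ _) df).
  have fg0 : \forall h \near (0 : V), f (h + x) = g (h + x).
    by move: fg; rewrite (near_shift 0) subr0.
  move=> He; near=> h.
  have -> : (g \o shift x - (cst (g x) + 'd f x)) h =
            (f \o shift x - (cst (f x) + 'd f x)) h.
    rewrite !fctE /= -(nbhs_singleton fg); congr (_ - _).
    by symmetry; near: h.
  by near: h.
have dgE : 'd g x = 'd f x :> (V -> W).
  by apply: diff_unique => //; exact: diff_continuous.
split => //; apply/diff_locallyP; rewrite dgE; split => //.
exact: diff_continuous.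
Unshelve. all: by end_near. Qed.

Lemma fst_cts (U V : topologicalType) : continuous (fst : U * V -> U).
Proof.
by move=> [u v] A uA; exists (A, setT) => [|[? ?] []//]; split => //; exact: filterT.
Qed.

Lemma snd_cts (U V : topologicalType) : continuous (snd : U * V -> V).
Proof.
by move=> [u v] A vA; exists (setT, A) => [|[? ?] []//]; split => //; exact: filterT.
Qed.

(* Manifolds modelled on a normed space E over K. For K = C and E of finite
   dimension these are complex manifolds: [differentiable] is differentiability
   over K, so being differentiable at every point of an open set means being
   holomorphic there. No separation axiom is imposed, as leaf spaces need not
   be Hausdorff.

   Each point x carries a preferred chart [chart_at x]; the tangent space at x
   is identified with E through the components in that chart. *)
Section Manifolds.
Context {K : numFieldType}.

Record atlas (E : normedModType K) (T : topologicalType) := Atlas {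
  chart : Type;
  cdom : chart -> set T;
  cmap : chart -> T -> E;
  cinv : chart -> E -> T;
  chart_at : T -> chart;
  open_cdom : forall c, open (cdom c);
  open_cimg : forall c, open (cmap c @` cdom c);
  cmap_continuous : forall c x, cdom c x -> {for x, continuous (cmap c)};
  cinv_continuous :
    forall c x, cdom c x -> {for cmap c x, continuous (cinv c)};
  cmapK : forall c x, cdom c x -> cinv c (cmap c x) = x;
  cdom_chart_at : forall x, cdom (chart_at x) x;
  transition_holo : forall c d x, cdom c x -> cdom d x ->
    differentiable (cmap d \o cinv c) (cmap c x) }.

Section OneManifold.
Context {E : normedModType K} {T : topologicalType} (A : atlas E T).
Implicit Types c d : chart A.

(* The tangent vector at x with components u in the chart c. *)
Definition tvec (c : chart A) (x : T) (u : E) : E :=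
  'd (cmap (chart_at A x) \o cinv c) (cmap c x) u.

(* The components in the chart c of the tangent vector u at x. *)
Definition tcomp (c : chart A) (x : T) (u : E) : E :=
  'd (cmap c \o cinv (chart_at A x)) (cmap (chart_at A x) x) u.

Lemma near_cinv c x (S : set T) : cdom c x -> open S -> S x ->
  \forall e \near cmap c x, S (cinv c e).
Proof.
move=> cx oS Sx; have := @cinv_continuous _ _ _ c x cx.
by apply; rewrite (cmapK cx); exact: open_nbhs_nbhs.
Qed.

Lemma tcomp_tvec c d x : cdom c x -> cdom d x ->
  tcomp d x \o tvec c x = 'd (cmap d \o cinv c) (cmap c x) :> (E -> E).
Proof.
move=> cx dx; set a := chart_at A x.
have ax : cdom a x := cdom_chart_at _ _.
have eqx : (cmap a \o cinv c) (cmap c x) = cmap a x by rewrite /= cmapK.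
have := @near_eq_diff _ _ _ ((cmap d \o cinv a) \o (cmap a \o cinv c))
  (cmap d \o cinv c) (cmap c x).
case.
- near=> e => /=; rewrite cmapK//.
  by near: e; apply: near_cinv => //; exact: open_cdom.
- apply: differentiable_comp; first exact: transition_holo.
  by rewrite eqx; exact: transition_holo.
move=> _ ->; rewrite diff_comp ?eqx//; exact: transition_holo.
Unshelve. all: by end_near. Qed.

Lemma tcompK c x th : cdom c x -> tvec c x (tcomp c x th) = th.
Proof.
move=> cx; rewrite /tvec /tcomp; set a := chart_at _ _.
have ax : cdom a x := cdom_chart_at _ _.
have eqx : (cmap c \o cinv a) (cmap a x) = cmap c x by rewrite /= cmapK.
have [||_ dE] := @near_eq_diff _ _ _
  ((cmap a \o cinv c) \o (cmap c \o cinv a)) idfun (cmap a x).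
- near=> e => /=; rewrite cmapK; last first.
    by near: e; apply: near_cinv => //; exact: open_cdom.
  have : (cmap a @` cdom a) e.
    by near: e; apply: open_nbhs_nbhs; split; [exact: open_cimg|exists x].
  by case=> y ay <-; rewrite cmapK.
- apply: differentiable_comp; first exact: transition_holo.
  by rewrite eqx; exact: transition_holo.
rewrite -[LHS]/(('d (cmap a \o cinv c) (cmap c x) \o
                 'd (cmap c \o cinv a) (cmap a x)) th) -eqx.
rewrite -diff_comp ?eqx; [|exact: transition_holo|exact: transition_holo].
by rewrite -dE diff_lin // => ? //.
Unshelve. all: by end_near. Qed.

Lemma tvecK c x th : cdom c x -> tcomp c x (tvec c x th) = th.
Proof.
move=> cx; rewrite -[LHS]/((tcomp c x \o tvec c x) th) tcomp_tvec//.
have [||_ ->] := @near_eq_diff _ _ _ idfun (cmap c \o cinv c) (cmap c x).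
- near=> e => /=.
  have : (cmap c @` cdom c) e.
    by near: e; apply: open_nbhs_nbhs; split; [exact: open_cimg|exists x].
  by case=> y cy <-; rewrite cmapK.
- by apply: linear_differentiable => ? //.
by rewrite diff_lin // => ? //.
Unshelve. all: by end_near. Qed.

Definition holo_fun (S : set T) (f : T -> K) : Prop :=
  forall x (c : chart A), S x -> cdom c x -> differentiable (f \o cinv c) (cmap c x).

Definition dfun (f : T -> K) (x : T) (u : E) : K :=
  'd (f \o cinv (chart_at A x)) (cmap (chart_at A x) x) u.

(* d log f = f^-1 df, which does not depend on the branch of log f. *)
Definition dlog (f : T -> K) (x : T) (u : E) : K := (f x)^-1 * dfun f x u.

(* Coefficients of forms in the chart c, as functions of the coordinates e. *)
Definition rep1 (c : chart A) (a : T -> E -> K) (u : E) (e : E) : K :=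
  a (cinv c e) (tvec c (cinv c e) u).

Definition rep2 (c : chart A) (b : T -> E -> E -> K) (u v : E) (e : E) : K :=
  b (cinv c e) (tvec c (cinv c e) u) (tvec c (cinv c e) v).

Definition form1_on (S : set T) (a : T -> E -> K) : Prop :=
  forall x, S x ->
    (forall k u v, a x (k *: u + v) = k * a x u + a x v) /\
    (forall (c : chart A) u, cdom c x -> differentiable (rep1 c a u) (cmap c x)).

Definition form2_on (S : set T) (b : T -> E -> E -> K) : Prop :=
  forall x, S x ->
    [/\ forall k u v w, b x (k *: u + v) w = k * b x u w + b x v w,
        forall u v, b x u v = - b x v u &
        forall (c : chart A) u v, cdom c x ->
          differentiable (rep2 c b u v) (cmap c x)].

(* Exterior derivatives, with (da)(u, v) = u(a(v)) - v(a(u)). *)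
Definition ext1 (a : T -> E -> K) (x : T) (u v : E) : K :=
  let c := chart_at A x in
  'D_u (rep1 c a v) (cmap c x) - 'D_v (rep1 c a u) (cmap c x).

Definition ext2 (b : T -> E -> E -> K) (x : T) (u v w : E) : K :=
  let c := chart_at A x in
  'D_u (rep2 c b v w) (cmap c x) + 'D_v (rep2 c b w u) (cmap c x)
  + 'D_w (rep2 c b u v) (cmap c x).

(* Lie derivative of a 1-form, by Cartan's formula d i_X + i_X d. *)
Definition lie1 (X : T -> E) (a : T -> E -> K) (x : T) (u : E) : K :=
  dfun (fun y => a y (X y)) x u + ext1 a x (X x) u.

Definition symplectic_form (b : T -> E -> E -> K) : Prop :=
  [/\ form2_on setT b,
      forall x u v w, ext2 b x u v w = 0 &
      forall x u, (forall v, b x u v = 0) -> u = 0].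

Definition symplectic_potential (S : set T) (a : T -> E -> K)
    (b : T -> E -> E -> K) : Prop :=
  [/\ open S, form1_on S a & forall x, S x -> ext1 a x = b x].

End OneManifold.

Section Maps.
Context {E F : normedModType K} {T U : topologicalType}.
Context (A : atlas E T) (B : atlas F U).

Definition holo_map (S : set T) (f : T -> U) : Prop :=
  forall x, S x -> {for x, continuous f} /\
    forall (c : chart A) (d : chart B), cdom c x -> cdom d (f x) ->
      differentiable (cmap d \o f \o cinv c) (cmap c x).

Definition tmap (f : T -> U) (x : T) (u : E) : F :=
  'd (cmap (chart_at B (f x)) \o f \o cinv (chart_at A x))
     (cmap (chart_at A x) x) u.

Definition pull1 (f : T -> U) (a : U -> F -> K) (x : T) (u : E) : K :=
  a (f x) (tmap f x u).

Definition pull2 (f : T -> U) (b : U -> F -> F -> K) (x : T) (u v : E) : K :=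
  b (f x) (tmap f x u) (tmap f x v).

Definition symplectic_map (S : set T) (f : T -> U)
    (b : T -> E -> E -> K) (b' : U -> F -> F -> K) : Prop :=
  holo_map S f /\ forall x, S x -> pull2 f b' x = b x.

Definition generating_function (S : set T) (f : T -> U)
    (a : T -> E -> K) (a' : U -> F -> K) (k : T -> K) : Prop :=
  holo_fun A S k /\
  forall x, S x -> forall u, dfun A k x u = a x u - pull1 f a' x u.

End Maps.
End Manifolds.

Section Wedge.
Context {K : numFieldType} {V : Type}.
Definition wedge (a b : V -> K) (u v : V) : K := a u * b v - a v * b u.
End Wedge.

Definition Cplx (R : realType) : numClosedFieldType := R[i]%C.

Definition cexp (R : realType) (z : Cplx R) : Cplx R :=
  Complex (expR (complex.Re z) * cos (complex.Im z))
          (expR (complex.Re z) * sin (complex.Im z)).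

Definition two_pi_i (R : realType) : Cplx R := Complex 0 (2 * pi).

(* Coordinates are row vectors, so an element of GL_n(Z) acts on the right. The
   matrix may depend on the connected component of the overlap. *)
Record period_structure (R : realType) (n : nat) (T : topologicalType) :=
  PeriodStructure {
  patlas :> atlas 'rV[Cplx R]_n T;
  integral_linear : forall (c d : chart patlas) (x : T),
    cdom c x -> cdom d x ->
    exists2 g : 'M[int]_n, g \in unitmx &
      \forall y \near x, cmap d y = cmap c y *m map_mx intr g }.

(* The total space of T_M; [tvect] lists the components in the distinguished
   chart [chart_at M tbase]. *)
Record tbundle (R : realType) (n : nat) (T : topologicalType)
    (M : period_structure R n T) := TVec { tbase : T; tvect : 'rV[Cplx R]_n }.

Section TangentBundle.
Context {R : realType} {n : nat} {T : topologicalType}.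
Context (M : period_structure R n T).
Local Notation E := 'rV[Cplx R]_n.

HB.instance Definition _ := gen_eqMixin (tbundle M).
HB.instance Definition _ := gen_choiceMixin (tbundle M).

(* The coordinates (z, theta) attached to the distinguished chart c. *)
Definition tb_cmap (c : chart M) (p : tbundle M) : E * E :=
  (cmap c (tbase p), tcomp c (tbase p) (tvect p)).

Definition tb_cinv (c : chart M) (e : E * E) : tbundle M :=
  TVec M (cinv c e.1) (tvec c (cinv c e.1) e.2).

Definition tb_open (S : set (tbundle M)) : Prop :=
  forall c : chart M,
    open [set e : E * E | (cmap c @` cdom c) e.1 /\ S (tb_cinv c e)].

Implicit Types c d : chart M.

Lemma tb_openT : tb_open setT.
Proof.
move=> c; rewrite (_ : mkset _ = fst @^-1` (cmap c @` cdom c)).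
  by apply: open_comp; [move=> e _; exact: fst_cts | exact: open_cimg].
by apply/seteqP; split => [e []|e].
Qed.

Lemma tb_openI : setI_closed tb_open.
Proof.
move=> S S' oS oS' c; rewrite (_ : mkset _ =
  [set e | (cmap c @` cdom c) e.1 /\ S (tb_cinv c e)] `&`
  [set e | (cmap c @` cdom c) e.1 /\ S' (tb_cinv c e)]).
  exact: openI.
by apply/seteqP; split => [e [? []]|e [[? ?] [_ ?]]].
Qed.

Lemma tb_open_bigU (I : Type) (f : I -> set (tbundle M)) :
  (forall i, tb_open (f i)) -> tb_open (\bigcup_i f i).
Proof.
move=> of_ c; rewrite (_ : mkset _ =
  \bigcup_i [set e | (cmap c @` cdom c) e.1 /\ f i (tb_cinv c e)]).
  by apply: bigcup_open => i _; exact: of_.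
by apply/seteqP; split => [e [ce [i _ fe]]|e [i _ [ce fe]]]; [exists i|split=> //; exists i].
Qed.

HB.instance Definition _ :=
  isOpenTopological.Build (tbundle M) tb_openT tb_openI tb_open_bigU.

Lemma tb_openE (S : set (tbundle M)) : open S = tb_open S.
Proof. by []. Qed.

Lemma mulmxr_continuous (g : 'M[Cplx R]_n) :
  continuous (mulmxr g : E -> E).
Proof.
move=> x; rewrite (_ : mulmxr g = fun z : E => \sum_i z 0 i *: row i g).
  apply: cvg_big => [||i _]; [exact: add_continuous|exact: nbhs_filter|].
  have := @coord_continuous (Cplx R) 1 n 0 i x.
  by apply: cvgZr_tmp; exact: (@nbhs_filter E).
by apply/funext => z; rewrite /mulmxr mulmx_sum_row.
Qed.

(* On an overlap of distinguished charts the transition function of T_M is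
   (z, theta) |-> (z g, theta g). *)
Lemma tb_transition c d x : cdom c x -> cdom d x ->
  exists g : 'M[Cplx R]_n, \forall z \near cmap c x,
    [/\ cdom c (cinv c z), cdom d (cinv c z), cmap d (cinv c z) = z *m g &
        forall th, tcomp d (cinv c z) (tvec c (cinv c z) th) = th *m g].
Proof.
move=> cx dx; have [g _ gE] := integral_linear cx dx.
exists (map_mx intr g); set G := map_mx _ _.
have imE : \forall z \near cmap c x, (cmap c @` cdom c) z.
  by apply: open_nbhs_nbhs; split; [exact: open_cimg|exists x].
have nE : \forall z \near cmap c x,
    [/\ cdom c (cinv c z), cdom d (cinv c z), cmap c (cinv c z) = z &
        cmap d (cinv c z) = z *m G].
  near=> z.
  have cz : (cmap c @` cdom c) z by near: z.
  have zE : cmap c (cinv c z) = z.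
    by case: cz => y cy <-; rewrite cmapK.
  split => //.
  - by near: z; exact: (near_cinv cx (open_cdom c) cx).
  - by near: z; exact: (near_cinv cx (open_cdom d) dx).
  - rewrite -[in RHS]zE; near: z.
    have [B [oB Bx BE]] : exists B, [/\ open B, B x & B `<=`
        [set y | cmap d y = cmap c y *m G]].
      exists (interior [set y | cmap d y = cmap c y *m G]); split.
      - exact: open_interior.
      - exact: gE.
      - exact: interior_subset.
    by have := near_cinv cx oB Bx; apply: filterS => z; exact: BE.
have nnE := near_join nE; near=> z.
have [cz dz zE zG] : [/\ cdom c (cinv c z), cdom d (cinv c z),
  cmap c (cinv c z) = z & cmap d (cinv c z) = z *m G] by near: z.
split => // th.
rewrite -[LHS]/((tcomp d (cinv c z) \o tvec c (cinv c z)) th) tcomp_tvec// zE.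
have : \forall z' \near z, [/\ cdom c (cinv c z'), cdom d (cinv c z'),
  cmap c (cinv c z') = z' & cmap d (cinv c z') = z' *m G] by near: z.
move=> zG'.
have [] := @near_eq_diff _ _ _ (mulmxr G) (cmap d \o cinv c) z.
- by apply: filterS zG' => z' [].
- by apply: linear_differentiable; exact: mulmxr_continuous.
by move=> _ ->; rewrite diff_lin//; exact: mulmxr_continuous.
Unshelve. all: by end_near. Qed.

Definition tb_dom (c : chart M) : set (tbundle M) := [set p | cdom c (tbase p)].

Lemma tb_cmapK c p : tb_dom c p -> tb_cinv c (tb_cmap c p) = p.
Proof.
by case: p => x th cx; rewrite /tb_cinv /tb_cmap /= cmapK// tcompK.
Qed.

Lemma tb_cinvK c e : (cmap c @` cdom c) e.1 ->
  tb_dom c (tb_cinv c e) /\ tb_cmap c (tb_cinv c e) = e.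
Proof.
case: e => z th /= [x cx <-]; rewrite /tb_dom /tb_cinv /tb_cmap /= !cmapK//.
split => //; congr pair.
by rewrite tvecK.
Qed.

Lemma tb_transition2 c d p : tb_dom c p -> tb_dom d p ->
  exists g : 'M[Cplx R]_n, \forall e \near tb_cmap c p,
    [/\ tb_dom c (tb_cinv c e), tb_dom d (tb_cinv c e) &
        tb_cmap d (tb_cinv c e) = (e.1 *m g, e.2 *m g)].
Proof.
case: p => x th cx dx; have [g gE] := tb_transition cx dx; exists g.
have : \forall e \near tb_cmap c (TVec M x th),
   [/\ cdom c (cinv c e.1), cdom d (cinv c e.1), cmap d (cinv c e.1) = e.1 *m g &
        forall th, tcomp d (cinv c e.1) (tvec c (cinv c e.1) th) = th *m g].
  exact: (@fst_cts E E (cmap c x, tcomp c x th) _ gE).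
apply: filterS => e [ce de eE tE]; split => //.
by rewrite /tb_cmap /tb_cinv /= eE tE.
Qed.

Lemma linear2_differentiable (g : 'M[Cplx R]_n) (e : E * E) :
  differentiable (fun e : E * E => (e.1 *m g, e.2 *m g)) e.
Proof.
have dg (z : E) : differentiable (mulmxr g : E -> E) z.
  by apply: linear_differentiable; exact: mulmxr_continuous.
apply: differentiable_pair.
- apply: (@differentiable_comp _ _ _ _ (fst : E * E -> E) (mulmxr g)) => //.
  by apply: linear_differentiable; exact: fst_cts.
- apply: (@differentiable_comp _ _ _ _ (snd : E * E -> E) (mulmxr g)) => //.
  by apply: linear_differentiable; exact: snd_cts.
Qed.

Lemma linear2_continuous (g : 'M[Cplx R]_n) :
  continuous (fun e : E * E => (e.1 *m g, e.2 *m g)).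
Proof. by move=> e; apply: differentiable_continuous; exact: linear2_differentiable. Qed.

Lemma linear2_near (g : 'M[Cplx R]_n) (e : E * E) (O : set (E * E)) :
  open O -> O (e.1 *m g, e.2 *m g) ->
  \forall e' \near e, O (e'.1 *m g, e'.2 *m g).
Proof.
by move=> oO Oe; apply: linear2_continuous; exact: open_nbhs_nbhs.
Qed.

Lemma tb_open_dom c : open (tb_dom c).
Proof.
rewrite tb_openE => d; rewrite openE => e [[x dx xe] ce].
have ee : tb_cmap d (tb_cinv d e) = e by have [] := @tb_cinvK d e; [exists x|].
have dd : tb_dom d (tb_cinv d e) by have [] := @tb_cinvK d e; [exists x|].
have [g] := tb_transition2 dd ce; rewrite ee => gE.
rewrite /interior; near=> e'.
have [? ? _] : [/\ tb_dom d (tb_cinv d e'), tb_dom c (tb_cinv d e') &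
        tb_cmap c (tb_cinv d e') = (e'.1 *m g, e'.2 *m g)] by near: e'.
split => //.
suff : (fst @^-1` (cmap d @` cdom d)) e' by [].
near: e'; apply: open_nbhs_nbhs; split; last by exists x.
by apply: open_comp; [move=> ? _; exact: fst_cts | exact: open_cimg].
Unshelve. all: by end_near. Qed.

Lemma tb_cimgE c : tb_cmap c @` tb_dom c = fst @^-1` (cmap c @` cdom c).
Proof.
apply/seteqP; split => [_ [p cp <-]|e ce]; first by exists (tbase p).
by have [? ?] := tb_cinvK ce; exists (tb_cinv c e).
Qed.

Lemma tb_open_img c : open (tb_cmap c @` tb_dom c).
Proof.
rewrite tb_cimgE.
by apply: open_comp; [move=> ? _; exact: fst_cts | exact: open_cimg].
Qed.

Lemma tb_cmap_continuous c p : tb_dom c p -> {for p, continuous (tb_cmap c)}.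
Proof.
move=> cp S nS; pose O := interior S.
have oO : open O := @open_interior (E * E)%type S.
have Op : O (tb_cmap c p) := nS.
have OS : O `<=` S := @interior_subset _ S.
rewrite /nbhs /=; exists (tb_dom c `&` tb_cmap c @^-1` O); split; [|by []|by move=> q [_ Oq]; exact: OS].
rewrite -/(tb_open _) => d; rewrite openE => e [de [ce Oe]].
have [dd ee] := tb_cinvK de.
have [g] := tb_transition2 dd ce; rewrite ee => gE.
have eg : tb_cmap c (tb_cinv d e) = (e.1 *m g, e.2 *m g).
  by have [] := nbhs_singleton gE.
have kO := @linear2_near g e O oO; rewrite -eg in kO; have {}kO := kO Oe.
have dO : \forall e' \near e, (fst @^-1` (cmap d @` cdom d)) e'.
  apply: open_nbhs_nbhs; split => //.
  by apply: open_comp; [move=> ? _; exact: fst_cts | exact: open_cimg].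
apply: filterS3 gE kO dO => e' [? ? e'E] Oe' de'.
split; [exact: de'|split; [assumption|]].
by rewrite /preimage/mkset e'E.
Qed.

Lemma tb_cinv_continuous c p :
  tb_dom c p -> {for tb_cmap c p, continuous (tb_cinv c)}.
Proof.
move=> cp S; rewrite tb_cmapK// => nS; pose O := interior S.
have oO : open O := @open_interior (tbundle M) S.
have Op : O p := nS.
have OS : O `<=` S := @interior_subset _ S.
have := oO; rewrite tb_openE => /(_ c) oc.
have : nbhs (tb_cmap c p)
    [set e | (cmap c @` cdom c) e.1 /\ O (tb_cinv c e)].
  apply: open_nbhs_nbhs; split => //; split; first by exists (tbase p).
  by rewrite tb_cmapK.
by apply: filterS => e [_ Oe]; exact: OS.
Qed.

Lemma tb_transition_holo c d p : tb_dom c p -> tb_dom d p ->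
  differentiable (tb_cmap d \o tb_cinv c) (tb_cmap c p).
Proof.
move=> cp dp; have [g gE] := tb_transition2 cp dp.
have [] := @near_eq_diff _ _ _ (fun e : E * E => (e.1 *m g, e.2 *m g))
  (tb_cmap d \o tb_cinv c) (tb_cmap c p) => //.
  by apply: filterS gE => e [].
exact: linear2_differentiable.
Qed.

Definition tb_atlas : atlas (E * E)%type (tbundle M) :=
  @Atlas _ (E * E)%type (tbundle M) (chart M) tb_dom tb_cmap tb_cinv
    (fun p => chart_at M (tbase p)) tb_open_dom tb_open_img tb_cmap_continuous
    tb_cinv_continuous tb_cmapK (fun p => cdom_chart_at M (tbase p))
    tb_transition_holo.

End TangentBundle.

(* The partial derivatives along z_i and theta_i, and the coordinate 1-forms
   dz_i and dtheta_i. *)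
Section Coordinates.
Context {R : realType} {n : nat}.
Local Notation C := (Cplx R).
Local Notation E := 'rV[C]_n.

Definition pz (i : 'I_n) (f : E * E -> C) (e : E * E) : C :=
  'D_(delta_mx 0 i, 0) f e.
Definition pth (i : 'I_n) (f : E * E -> C) (e : E * E) : C :=
  'D_(0, delta_mx 0 i) f e.

Definition dz (i : 'I_n) (u : E * E) : C := u.1 0 i.
Definition dth (i : 'I_n) (u : E * E) : C := u.2 0 i.

(* The horizontal lift at e of the tangent vector sum_i a_i d/dz_i. *)
Definition hlift (eta : 'M[C]_n) (W : E * E -> C) (e : E * E) (a : E) : E * E :=
  (a, \row_q \sum_i a 0 i * \sum_p eta p q * pth i (pth p W) e).

End Coordinates.

(* The connection jconn is a global object, expressed in each distinguished
   chart c by a function jW c. The normalisation along theta = 0 determines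
   jW c, and the fibres of T_M are simply connected, so jW c is defined on the
   whole of the part of T_M over the domain of c. The homogeneity of jW c is
   required whenever both sides are defined. *)
Record joyce_structure (R : realType) (n : nat) (T : topologicalType)
    (M : period_structure R n T) := JoyceStructure {
  jomega : T -> 'rV[Cplx R]_n -> 'rV[Cplx R]_n -> Cplx R;
  jomega_mx : chart M -> 'M[Cplx R]_n;
  jW : chart M -> 'rV[Cplx R]_n * 'rV[Cplx R]_n -> Cplx R;
  jconn : tbundle M -> 'rV[Cplx R]_n -> 'rV[Cplx R]_n * 'rV[Cplx R]_n;
  jeta := fun c => invmx (jomega_mx c);

  jomega_symplectic : symplectic_form M jomega;
  jomegaE : forall c x u v, cdom c x ->
    jomega x (tvec c x u) (tvec c x v) =
    2^-1 * \sum_p \sum_q jomega_mx c p q *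
             wedge (fun w : 'rV_n => w 0 p) (fun w : 'rV_n => w 0 q) u v;
  jomega_skew : forall c, (jomega_mx c)^T = - jomega_mx c;
  jomega_unit : forall c, jomega_mx c \in unitmx;
  jeta_int : forall c p q, exists m : int, jeta c p q = two_pi_i R * m%:~R;

  jW_holo : forall c e,
    (cmap c @` cdom c) e.1 -> differentiable (jW c) e;
  jconnE : forall c p a, cdom c (tbase p) ->
    jconn p (tvec c (tbase p) a) =
    @tvec _ _ _ (tb_atlas M) c p (hlift (jeta c) (jW c) (tb_cmap c p) a);
  jW_zero : forall c z, (cmap c @` cdom c) z -> jW c (z, 0) = 0;
  jW_pth_zero : forall c z i,
    (cmap c @` cdom c) z -> pth i (jW c) (z, 0) = 0;
  jW_pde : forall c e i j, (cmap c @` cdom c) e.1 ->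
    pth i (pz j (jW c)) e - pth j (pz i (jW c)) e =
    \sum_p \sum_q jeta c p q * pth i (pth p (jW c)) e *
                               pth j (pth q (jW c)) e;
  jW_periodic : forall c z th (k : 'rV[int]_n) i j, (cmap c @` cdom c) z ->
    pth i (pth j (jW c)) (z, th + two_pi_i R *: map_mx intr k) =
    pth i (pth j (jW c)) (z, th);
  jW_homogeneous : forall c z th (lam : Cplx R), lam != 0 ->
    (cmap c @` cdom c) z -> (cmap c @` cdom c) (lam *: z) ->
    jW c (lam *: z, th) = lam^-1 * jW c (z, th);
  jW_odd : forall c z th, (cmap c @` cdom c) z ->
    jW c (z, - th) = - jW c (z, th) }.

Section Joyce.
Context {R : realType} {n : nat} {T : topologicalType}.
Context {M : period_structure R n T} (J : joyce_structure M).
Local Notation C := (Cplx R).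
Local Notation E := 'rV[C]_n.
Local Notation X := (tb_atlas M).

(* The bundle map h_epsilon = h + epsilon^-1 v, as a function of t = epsilon^-1,
   so that t = 0 is epsilon = infinity. *)
Definition jconn_eps (t : C) (p : tbundle M) (a : E) : E * E :=
  jconn J p a + t *: (0, a).

Definition euler_base (x : T) : E := cmap (chart_at M x) x.
Definition euler (p : tbundle M) : E * E := (euler_base (tbase p), 0).

(* The forms Omega_+, Omega_I, Omega_- and Theta_I, in the coordinates (z, theta)
   of the preferred distinguished chart; the expressions are the same in every
   distinguished chart. *)
Definition Omega_plus (p : tbundle M) (u v : E * E) : C :=
  let om := jomega_mx J (chart_at M (tbase p)) in
  2^-1 * \sum_p \sum_q om p q * wedge (dz p) (dz q) u v.

Definition Omega_I (p : tbundle M) (u v : E * E) : C :=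
  let om := jomega_mx J (chart_at M (tbase p)) in
  (2 * 'i)^-1 * - \sum_p \sum_q om p q * wedge (dz p) (dth q) u v.

Definition Omega_minus (p : tbundle M) (u v : E * E) : C :=
  let c := chart_at M (tbase p) in
  let om := jomega_mx J c in
  let W := jW J c in
  let e := tb_cmap c p in
  2^-1 * (\sum_p \sum_q om p q * wedge (dth p) (dth q) u v)
  + \sum_p \sum_q pth p (pth q W) e * wedge (dth p) (dz q) u v
  + \sum_p \sum_q pz p (pth q W) e * wedge (dz p) (dz q) u v.

Definition Theta_I (p : tbundle M) (u : E * E) : C := Omega_I p (euler p) u.

(* q : Y -> Z is the quotient of the open subset Y of T_M by the leaves of the
   foliation im(h_epsilon) of Y, with Z a complex manifold: a surjective
   submersion with connected fibres tangent to im(h_epsilon). The global twistor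
   fibre Z_epsilon is the case Y = setT. *)
Definition twistor_fibre (t : C) (Y : set (tbundle M)) {Z : topologicalType}
    (B : atlas E Z) (q : tbundle M -> Z) : Prop :=
  [/\ open Y /\ holo_map X B Y q,
      q @` Y = setT,
      forall p, Y p -> forall w, exists u, tmap X B q p u = w,
      forall p, Y p -> forall u,
        tmap X B q p u = 0 <-> exists a, u = jconn_eps t p a &
      forall z, connected (Y `&` q @^-1` [set z])].

(* The symplectic form Omega_epsilon on the twistor fibre, t = epsilon^-1. *)
Definition twistor_symplectic (t : C) (Y : set (tbundle M))
    {Z : topologicalType} (B : atlas E Z) (q : tbundle M -> Z)
    (Om : Z -> E -> E -> C) : Prop :=
  symplectic_form B Om /\
  forall p, Y p -> forall u v, pull2 X B q Om p u v =
    t ^+ 2 * Omega_plus p u v + 2 * 'i * t * Omega_I p u v + Omega_minus p u v.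

Definition zero_section (x : T) : tbundle M := TVec M x 0.

Definition tau_function {Z1 Zoo : topologicalType} (B1 : atlas E Z1)
    (Boo : atlas E Zoo) (q1 : tbundle M -> Z1) (qoo : tbundle M -> Zoo)
    (Th0 : T -> E -> C) (Th1 : Z1 -> E -> C) (Thoo : Zoo -> E -> C)
    (V : set (tbundle M)) (tau : tbundle M -> C) : Prop :=
  [/\ open V, holo_fun X V tau, forall p, V p -> tau p != 0 &
      forall p, V p -> forall u, dlog X tau p u =
        pull1 X M (@tbase _ _ _ M) Th0 p u + 2 * 'i * Theta_I p u
        + pull1 X Boo qoo Thoo p u - pull1 X B1 q1 Th1 p u].

End Joyce.

Arguments euler_base {R n T} M x.
Arguments zero_section {R n T} M x.

(* Main.v *)
Require Import Defs.
From HB Require Import structures.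
From mathcomp Require Import all_boot all_order all_algebra.
From mathcomp Require Import all_classical all_reals all_analysis.
From mathcomp Require Import complex ring lra.
Set Implicit Arguments.
Unset Strict Implicit.
Unset Printing Implicit Defensive.
Import Order.TTheory GRing.Theory Num.Theory.
Import numFieldNormedType.Exports.
Local Open Scope classical_set_scope.
Local Open Scope ring_scope.

(** The point is that the zero-section is a leaf of the foliation im(h) that
    defines Z_infinity. Since W is odd in theta, its second theta-derivatives are
    odd and vanish along theta = 0, so there h maps d/dz_i to the tangent vector
    d/dz_i of the zero-section (lemma jconn_zero_section). Hence the
    differential of q_infinity kills the vectors tangent to the zero-section, and
    the pullback of Theta_infinity to M vanishes (pull1_leaf_zero_section). The form Theta_I has only dtheta components and
    vanishes too, while pi o j is the identity, so only Theta_0 and the pullback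
    of Theta_1 survive in d log tau. The statement uses d log f = f^-1 df, which
    is compatible with restriction along j by the chain rule in charts.

    That q_1 o j is symplectic amounts to j^* of Omega_+ + 2i Omega_I + Omega_-
    being omega. The pullback of Omega_- vanishes for the same reason as above,
    together with dW/dtheta_q = 0 along theta = 0 for its dz_p dz_q component.

    For a branch k of the logarithm, dk = d log(exp k) is the chain rule for the
    complex derivative of exp, which is obtained here from the real expansions of
    exp, sin and cos at the origin (is_derive_cexp). *)

(** * Chain rules in charts *)

Section Charts.
Context {K : numFieldType} {E F : normedModType K} {T U : topologicalType}.
Context (A : atlas E T) (B : atlas F U).

Lemma near_cmapK (c : chart A) (x : T) : cdom c x ->
  \forall e \near cmap c x, cdom c (cinv c e) /\ cmap c (cinv c e) = e.
Proof.
move=> cx; have : \forall e \near cmap c x, (cmap c @` cdom c) e.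
  by apply: open_nbhs_nbhs; split; [exact: open_cimg|exists x].
by apply: filterS => _ [y cy <-]; rewrite cmapK.
Qed.

Lemma tvec_chart_at (x : T) (u : E) : tvec (chart_at A x) x u = u.
Proof.
have cx := cdom_chart_at A x.
rewrite /tvec; have [||_ ->] := @near_eq_diff _ _ _ idfun
  (cmap (chart_at A x) \o cinv (chart_at A x)) (cmap (chart_at A x) x).
- by apply: filterS (near_cmapK cx) => e [_ /= ->].
- by apply: linear_differentiable => ? //.
by rewrite diff_lin // => ? //.
Qed.

(** The chain rule across one intermediate chart d. The target of g is a vector
    space, so that both functions on U and chart components of maps out of U are
    covered. *)
Lemma local_chain_rule {G : normedModType K} (f : T -> U) (g : U -> G) (x : T)
    (c : chart A) (d : chart B) :
  cdom c x -> cdom d (f x) -> {for x, continuous f} ->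
  differentiable (cmap d \o f \o cinv c) (cmap c x) ->
  differentiable (g \o cinv d) (cmap d (f x)) ->
  differentiable (g \o f \o cinv c) (cmap c x) /\
  'd (g \o f \o cinv c) (cmap c x) =
  'd (g \o cinv d) (cmap d (f x)) \o 'd (cmap d \o f \o cinv c) (cmap c x)
  :> (E -> G).
Proof.
move=> cx dfx fc df dg.
have eqx : (cmap d \o f \o cinv c) (cmap c x) = cmap d (f x) by rewrite /= cmapK.
have dcomp : differentiable ((g \o cinv d) \o (cmap d \o f \o cinv c)) (cmap c x).
  by apply: differentiable_comp; rewrite ?eqx.
have [||? ->] := @near_eq_diff _ _ _
  ((g \o cinv d) \o (cmap d \o f \o cinv c)) (g \o f \o cinv c) (cmap c x) => //.
- have dfn : \forall y \near x, cdom d (f y).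
    by apply: fc; apply: open_nbhs_nbhs; split => //; exact: open_cdom.
  have : \forall e \near cmap c x, cdom d (f (cinv c e)).
    have cc : cinv c @ cmap c x --> x.
      by rewrite -[X in _ --> X](cmapK cx); exact: cinv_continuous.
    exact: cc _ dfn.
  by apply: filterS => e de /=; rewrite cmapK.
by rewrite diff_comp ?eqx.
Qed.

Lemma dfun_comp (S : set T) (O : set U) (f : T -> U) (k : U -> K) (x : T) (u : E) :
  S x -> O (f x) -> holo_map A B S f -> holo_fun B O k ->
  dfun A (k \o f) x u = dfun B k (f x) (tmap A B f x u).
Proof.
move=> Sx Ofx hf hk; have [fc fd] := hf x Sx.
have cx := cdom_chart_at A x; have dfx := cdom_chart_at B (f x).
by rewrite /dfun; have [_ ->] :=
  local_chain_rule cx dfx fc (fd _ _ cx dfx) (hk _ _ Ofx dfx).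
Qed.

Lemma tmap_comp {G : normedModType K} {V : topologicalType} (D : atlas G V)
    (S : set T) (O : set U) (f : T -> U) (g : U -> V) (x : T) (u : E) :
  S x -> O (f x) -> holo_map A B S f -> holo_map B D O g ->
  tmap A D (g \o f) x u = tmap B D g (f x) (tmap A B f x u).
Proof.
move=> Sx Ofx hf hg; have [fc fd] := hf x Sx; have [_ gd] := hg _ Ofx.
have cx := cdom_chart_at A x; have dfx := cdom_chart_at B (f x).
have ey := cdom_chart_at D (g (f x)).
by rewrite /tmap; have [_ /= ->] :=
  local_chain_rule cx dfx fc (fd _ _ cx dfx) (gd _ _ dfx ey).
Qed.

Lemma holo_map_comp {G : normedModType K} {V : topologicalType} (D : atlas G V)
    (S : set T) (O : set U) (f : T -> U) (g : U -> V) :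
  holo_map A B S f -> holo_map B D O g ->
  holo_map A D (S `&` f @^-1` O) (g \o f).
Proof.
move=> hf hg x [Sx Ofx]; have [fc fd] := hf x Sx; have [gc gd] := hg _ Ofx.
split=> [|c e cx ey]; first exact: continuous_comp.
have dfx := cdom_chart_at B (f x).
by have [] := local_chain_rule cx dfx fc (fd _ _ cx dfx) (gd _ _ dfx ey).
Qed.

End Charts.

(** * Directional derivatives of functions with a parity *)

Section OddEven.
Context {K : numFieldType} {V : normedModType K}.

(** An equality of limits that holds also when they do not exist: both filters
    are the same, since the punctured neighbourhoods of 0 are symmetric. *)
Lemma lim_dnbhs0N (q : K -> K) : lim (q (- h) @[h --> 0^']) = lim (q h @[h --> 0^']).
Proof.
have N S : (0 : K)^' S -> (0 : K)^' [set h | S (- h)].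
  rewrite -{1}(@oppr0 K) dnbhsN => -[A hA <-].
  by apply: filterS hA => h Ah; exists h.
suff -> : q (- h) @[h --> 0^'] = q h @[h --> 0^'] by [].
apply/seteqP; split => S /= /N //.
by apply: filterS => h; rewrite /= opprK.
Qed.

(** Point reflection from x to y changes the sign of f and of the direction v;
    the two signs cancel. *)
Lemma derive_odd (f : V -> K) (x y v : V) :
  (forall h, f (h *: v + x) = - f (- h *: v + y)) ->
  'D_v f x = 'D_v f y.
Proof.
move=> fodd; rewrite /derive -lim_dnbhs0N.
suff -> : (fun h : K => (- h)^-1 *: ((f \o shift x) (- h *: v) - f x)) =
          (fun h : K => h^-1 *: ((f \o shift y) (h *: v) - f y)) by [].
apply/funext => h /=.
have := fodd 0; rewrite oppr0 scale0r !add0r => ->.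
by rewrite fodd !opprK invrN scaleNr -scalerN opprD opprK.
Qed.

(** The difference quotient is odd in h, so its limit is its own opposite if it
    exists; otherwise the derivative takes the default value, which is also 0.
    Treating both cases evaluates the second theta-derivatives of W at theta = 0
    without an appeal to the holomorphy of the partial derivatives of a
    holomorphic function. *)
Lemma derive_even (f : V -> K) (x v : V) :
  (forall h, f (h *: v + x) = f (- h *: v + x)) -> 'D_v f x = 0.
Proof.
move=> fev; rewrite /derive; set q := fun h : K => _.
have qN h : q (- h) = - q h by rewrite /q /= -fev invrN scaleNr.
have [cq|/dvgP//] := pselect (cvg (q h @[h --> 0^'])).
have /eqP := lim_dnbhs0N q; under eq_fun do rewrite qN.
by rewrite limN// -subr_eq0 -opprD oppr_eq0 -mulr2n mulrn_eq0 => /eqP.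
Qed.

End OddEven.

(** * The complex derivative of the exponential *)

Section ComplexExponential.
Context {R : realType}.
Local Notation C := (Cplx R).

Lemma cexpD (z w : C) : cexp (z + w) = cexp z * cexp w.
Proof.
case: z w => [a b] [c d]; apply/eqP; rewrite eq_complex /= expRD cosD sinD.
by apply/andP; split; apply/eqP; ring.
Qed.

Lemma is_derive_expansion (f : R -> R) (df e : R) : is_derive (0 : R) 1 f df ->
  0 < e -> \forall h \near 0, `|f h - f 0 - h * df| <= e * `|h|.
Proof.
move=> [fd <-] e0; have /derivable_nbhsP/eqaddoP/(_ e e0) := fd.
apply: filterS => h.
by rewrite !fctE /= addr0 /GRing.scale /= mulr1 opprD addrA.
Qed.

(** The real and imaginary parts of exp(x + iy) - 1 - (x + iy) are o(|x| + |y|).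
    If the expansions of exp, sin and cos at 0 hold up to r|h| and if exp x is at
    most 2 and within r of 1, the two parts add up to at most r|x| + 5r|y|,
    whence the choice r = e / 5. *)
Lemma cexp_expansion (e : R) : 0 < e ->
  exists2 d : R, 0 < d & forall x y : R, `|x| < d -> `|y| < d ->
    `|expR x * cos y - 1 - x| + `|expR x * sin y - y| <= e * (`|x| + `|y|).
Proof.
move=> e0; have e5 : 0 < e / 5 by rewrite divr_gt0.
set r := e / 5 in e5.
have eE : e = 5 * r by rewrite /r; field.
have c_exp : \forall x \near (0 : R), `|1 - expR x| <= Num.min r 1.
  have : {for (0 : R), continuous (@expR R)} by exact: continuous_expR.
  move=> /cvgrPdist_le /(_ (Num.min r 1)); rewrite expR0; apply.
  by rewrite lt_min e5 /=.
have d_exp := is_derive_expansion (is_derive_expR 0) e5.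
have d_sin := is_derive_expansion (is_derive_sin 0) e5.
have d_cos := is_derive_expansion (is_derive_cos 0) e5.
have /nbhs_norm0P[d /= d0 dP] : \forall x \near (0 : R),
    [/\ `|1 - expR x| <= r, `|1 - expR x| <= 1, `|expR x - 1 - x| <= r * `|x|,
        `|sin x - x| <= r * `|x| & `|cos x - 1| <= r * `|x|].
  near=> x.
  have : `|1 - expR x| <= Num.min r 1 by near: x.
  rewrite le_min => /andP[? ?]; split => //.
  - have : `|expR x - expR 0 - x * expR 0| <= r * `|x| by near: x.
    by rewrite expR0 mulr1.
  - have : `|sin x - sin 0 - x * cos 0| <= r * `|x| by near: x.
    by rewrite sin0 cos0 subr0 mulr1.
  - have : `|cos x - cos 0 - x * - sin 0| <= r * `|x| by near: x.
    by rewrite sin0 cos0 oppr0 mulr0 subr0.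
exists d => // x y xd yd.
have [e1 e2 e3 _ _] := dP x xd; have [_ _ _ s1 c1] := dP y yd.
have ex2 : `|expR x| <= 2.
  rewrite (_ : expR x = 1 - (1 - expR x)); last by ring.
  by apply: le_trans (ler_normB _ _) _; rewrite normr1 (_ : 2 = 1 + 1) // lerD2l.
have a : `|expR x * cos y - 1 - x| <= 2 * (r * `|y|) + r * `|x|.
  rewrite (_ : _ - x = expR x * (cos y - 1) + (expR x - 1 - x)); last by ring.
  apply: le_trans (ler_normD _ _) _; rewrite lerD// normrM.
  by rewrite ler_pM.
have b : `|expR x * sin y - y| <= 2 * (r * `|y|) + r * `|y|.
  rewrite (_ : _ - y = expR x * (sin y - y) + - (1 - expR x) * y); last by ring.
  apply: le_trans (ler_normD _ _) _; rewrite lerD// normrM ?normrN.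
    by rewrite ler_pM.
  by rewrite ler_wpM2r.
apply: le_trans (lerD a b) _; rewrite eE.
have : 0 <= r * `|x| by rewrite mulr_ge0// ltW.
by have : 0 <= r * `|y| by [rewrite mulr_ge0// ltW]; lra.
Unshelve. all: by end_near. Qed.

Lemma norm_complex_le (a b : R) : `|Complex a b : C| <= (`|a| + `|b|)%:C%C.
Proof.
rewrite normc_def lecR /= -[leRHS]ger0_norm ?addr_ge0// -sqrtr_sqr ler_wsqrtr//.
rewrite -(real_normK (num_real a)) -(real_normK (num_real b)) sqrrD.
by rewrite lerD2r lerDl mulrn_wge0 ?mulr_ge0.
Qed.

Lemma norm_Re_Im (h : C) : `|complex.Re h|%:C%C <= `|h| /\ `|complex.Im h|%:C%C <= `|h|.
Proof.
split; first exact: normc_ge_Re.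
rewrite normc_def lecR -sqrtr_sqr ler_wsqrtr// lerDr sqr_ge0//.
Qed.

(** By the addition formula it is enough to treat the origin, where the claim is
    the first-order expansion of cexp. *)
Lemma is_derive_cexp (w : C) : is_derive w (1 : C) (@cexp R) (cexp w).
Proof.
suff h : h^-1 *: ((@cexp R \o shift w) (h *: (1 : C)) - cexp w) @[h --> (0 : C)^'] --> cexp w.
  by split; [exact: cvgP h|exact: cvg_lim h].
have -> : (fun h : C => h^-1 *: ((@cexp R \o shift w) (h *: (1 : C)) - cexp w)) =
          (fun h : C => cexp w * (h^-1 * (cexp h - 1))).
  apply/funext => h; rewrite /GRing.scale /= mulr1 cexpD; ring.
rewrite -[X in _ --> X]mulr1; apply: cvgMr.
apply/cvgrPdist_le => e e0.
have eE : e = (complex.Re e)%:C%C by rewrite RRe_real ?gtr0_real.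
have Re0 : 0 < complex.Re e by rewrite -ltcR -eE.
have [|d d0 dP] := @cexp_expansion (complex.Re e / 2); first by rewrite divr_gt0.
have dC : (0 : C) < d%:C%C by rewrite ltcR.
near=> h.
have h0 : h != 0 by near: h; exact: nbhs_dnbhs_neq.
have hd : `|h| < d%:C%C by near: h; exact: dnbhs0_lt.
have [hx hy] := norm_Re_Im h.
rewrite (_ : 1 - _ = - (h^-1 * (cexp h - 1 - h))); last by field.
rewrite normrN normrM normfV ler_pdivrMl ?normr_gt0//.
have -> : cexp h - 1 - h =
    Complex (expR (complex.Re h) * cos (complex.Im h) - 1 - complex.Re h)
            (expR (complex.Re h) * sin (complex.Im h) - complex.Im h).
  by case: (h) => x y; apply/eqP; rewrite eq_complex /= subr0 !eqxx.
apply: le_trans (norm_complex_le _ _) _.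
have le_e : (complex.Re e / 2 * (`|complex.Re h| + `|complex.Im h|))%:C%C <= `|h| * e.
  rewrite {2}eE rmorphM rmorphD mulrC /=.
  have -> : `|h| * (complex.Re e)%:C%C = (`|h| + `|h|) * (complex.Re e / 2)%:C%C.
    by rewrite [in RHS]rmorphM fmorphV rmorph_nat; field.
  by rewrite ler_wpM2r ?lerD// lecR divr_ge0// ltW.
apply: le_trans le_e; rewrite lecR dP//.
  by rewrite -ltcR; exact: le_lt_trans hd.
by rewrite -ltcR; exact: le_lt_trans hd.
Unshelve. all: by end_near. Qed.

End ComplexExponential.

(** * The differential of a branch of the logarithm *)

Section LogarithmicDerivative.
Context {K : numFieldType} {E : normedModType K} {T : topologicalType}.
Context (A : atlas E T).

(** If exp is its own derivative then d(exp k) = exp(k) dk, and exp(k) cancels in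
    the logarithmic derivative. *)
Lemma dlog_exp (exp : K -> K) (S : set T) (k f : T -> K) (x : T) (u : E) :
  (forall w, is_derive (w : K) (1 : K) exp (exp w)) -> (forall w : K, exp w != 0) ->
  open S -> S x -> holo_fun A S k -> (forall y, S y -> exp (k y) = f y) ->
  dlog A f x u = dfun A k x u.
Proof.
move=> dexp exp0 oS Sx hk kf; have cx := cdom_chart_at A x.
have dk := hk _ _ Sx cx.
have [/derivable1_diffP de ve] := dexp (k x).
have kx : (k \o cinv (chart_at A x)) (cmap (chart_at A x) x) = k x by rewrite /= cmapK.
rewrite /dlog /dfun -(kf x Sx).
have [||_ ->] := @near_eq_diff _ _ _
  (exp \o (k \o cinv (chart_at A x))) (f \o cinv (chart_at A x))
  (cmap (chart_at A x) x).
- by apply: filterS (near_cinv cx oS Sx) => e Se /=; rewrite kf.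
- by apply: differentiable_comp; rewrite ?kx.
rewrite diff_comp ?kx// /= diff1E// derive1E ve /GRing.scale /=.
by rewrite mulrCA mulVf ?mulr1.
Qed.

End LogarithmicDerivative.

Section ComplexLogarithm.
Context {R : realType} {E : normedModType (Cplx R)} {T : topologicalType}.
Context (A : atlas E T).
Local Notation C := (Cplx R).

Lemma cexp_neq0 (w : C) : cexp w != 0.
Proof.
have : cexp w * cexp (- w) = 1.
  rewrite -cexpD subrr; apply/eqP.
  by rewrite eq_complex /= expR0 cos0 sin0 mulr1 mulr0 !eqxx.
by apply: contra_eq_neq => ->; rewrite mul0r eq_sym oner_neq0.
Qed.

Lemma dlog_cexp (S : set T) (k f : T -> C) (x : T) (u : E) :
  open S -> S x -> holo_fun A S k -> (forall y, S y -> cexp (k y) = f y) ->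
  dlog A f x u = dfun A k x u.
Proof.
exact: (@dlog_exp (Cplx R) E T A (@cexp R) S k f x u is_derive_cexp cexp_neq0).
Qed.

End ComplexLogarithm.

(** * The zero-section in charts *)

Lemma diff_pair0 (K : numFieldType) (V W : normedModType K) (x : V) :
  differentiable (fun e : V => (e, 0 : W)) x /\
  'd (fun e : V => (e, 0 : W)) x = (fun u => (u, 0)) :> (V -> V * W).
Proof.
split; first exact: differentiable_pair.
have d_id : 'd (fun e : V => e) x = id :> (V -> V) by exact: diff_val.
have d_0 : 'd (fun=> 0 : W) x = 0 :> (V -> W) by exact: diff_cst.
by rewrite diff_pair// d_id d_0.
Qed.

Section ZeroSection.
Context {R : realType} {n : nat} {T : topologicalType}.
Context (M : period_structure R n T).
Local Notation C := (Cplx R).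
Local Notation E := 'rV[C]_n.
Local Notation X := (tb_atlas M).
Local Notation j := (zero_section M).

Lemma tb_cmap_zero_section (c : chart M) (x : T) : tb_cmap c (j x) = (cmap c x, 0).
Proof. by rewrite /tb_cmap /= /tcomp linear0. Qed.

Lemma zero_section_continuous : continuous j.
Proof.
move=> x; have cx := cdom_chart_at M x; set c := chart_at M x in cx *.
have jE : \forall y \near x, tb_cinv c (cmap c y, 0) = j y.
  have : \forall y \near x, cdom c y.
    by apply: open_nbhs_nbhs; split => //; exact: open_cdom.
  by apply: filterS => y cy; rewrite /tb_cinv /= cmapK// /tvec linear0.
apply: cvg_trans (near_eq_cvg jE) _.
have ic : {for (cmap c x, 0 : E), continuous (tb_cinv c)}.
  by rewrite -tb_cmap_zero_section; exact: tb_cinv_continuous.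
have pc : {for cmap c x, continuous (fun e : E => (e, 0 : E))}.
  by apply: differentiable_continuous; exact: differentiable_pair.
have -> : j x = tb_cinv c (cmap c x, 0) by rewrite -(nbhs_singleton jE).
exact: (continuous_comp (cmap_continuous cx) (continuous_comp pc ic)).
Qed.

Lemma diff_zero_section (c : chart M) (x : T) : cdom c x ->
  differentiable (tb_cmap c \o j \o cinv c) (cmap c x) /\
  'd (tb_cmap c \o j \o cinv c) (cmap c x) = (fun u => (u, 0)) :> (E -> E * E).
Proof.
move=> cx; have [di <-] := @diff_pair0 _ E E (cmap c x).
apply: near_eq_diff di.
by apply: filterS (near_cmapK cx) => e [_ ee] /=; rewrite tb_cmap_zero_section ee.
Qed.

Lemma holo_zero_section : holo_map M X setT j.
Proof.
move=> x _; split=> [|c d cx dx]; first exact: zero_section_continuous.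
have [dj _] := diff_zero_section cx.
have cjx : tb_dom c (j x) by [].
by have [] := @local_chain_rule _ _ _ _ _ M X _ j (tb_cmap d) x c c cx cjx
  (@zero_section_continuous x) dj (tb_transition_holo cjx dx).
Qed.

Lemma tmap_zero_section (x : T) (u : E) : tmap M X j x u = (u, 0).
Proof. by rewrite /tmap; have [_ ->] := diff_zero_section (cdom_chart_at M x). Qed.

Lemma tmap_tbase (p : tbundle M) (w : E * E) : tmap X M (@tbase _ _ _ M) p w = w.1.
Proof.
have cx := cdom_chart_at M (tbase p); set c := chart_at M _ in cx.
have dfst : differentiable (fst : E * E -> E) (tb_cmap c p).
  by apply: linear_differentiable; exact: fst_cts.
rewrite /tmap; have [||_ ->] := @near_eq_diff _ _ _ (fst : E * E -> E)
  (cmap c \o (@tbase _ _ _ M) \o tb_cinv c) (tb_cmap c p) => //.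
- have := @near_cmapK _ _ _ X c p cx.
  by apply: filterS => e [_ {1}<-].
by rewrite diff_lin//; exact: fst_cts.
Qed.

End ZeroSection.

(** * Restriction of the Joyce structure to the zero-section *)

Lemma line_continuous (K : numFieldType) (V : normedModType K) (z v : V) :
  continuous (fun h : K => h *: v + z).
Proof. by move=> h; exact: (cvgD (@scalel_continuous K V v h) (cvg_cst z)). Qed.

Lemma pair_line (K : pzRingType) (V W : lmodType K) (h : K) (a z : V) (b t : W) :
  h *: (a, b) + (z, t) = (h *: a + z, h *: b + t).
Proof. by []. Qed.

Section JoyceZeroSection.
Context {R : realType} {n : nat} {T : topologicalType}.
Context {M : period_structure R n T} (J : joyce_structure M).
Local Notation C := (Cplx R).
Local Notation E := 'rV[C]_n.
Local Notation X := (tb_atlas M).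
Local Notation j := (zero_section M).

(** As W is odd in theta, the point reflection theta -> - theta preserves its
    first theta-derivatives. *)
Lemma pth_jW_even (c : chart M) (z th : E) (p : 'I_n) : (cmap c @` cdom c) z ->
  pth p (jW J c) (z, - th) = pth p (jW J c) (z, th).
Proof.
move=> cz; apply: derive_odd => h.
rewrite !pair_line !scaler0 !add0r.
by rewrite -jW_odd// opprD scaleNr opprK.
Qed.

Lemma pth_pth_jW_zero (c : chart M) (z : E) (i p : 'I_n) :
  (cmap c @` cdom c) z -> pth i (pth p (jW J c)) (z, 0) = 0.
Proof.
move=> cz; apply: derive_even => h.
rewrite !pair_line !scaler0 !add0r !addr0.
by rewrite scaleNr pth_jW_even.
Qed.

(** The function dW/dtheta_q vanishes on the zero-section only, but the
    difference quotient along d/dz_p stays inside it for small steps. *)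
Lemma pz_pth_jW_zero (c : chart M) (z : E) (p q : 'I_n) :
  (cmap c @` cdom c) z -> pz p (pth q (jW J c)) (z, 0) = 0.
Proof.
move=> cz; apply: cvg_lim => //; apply: cvg_near_cst.
have zc : {for (0 : C), continuous (fun h : C => h *: (delta_mx 0 p : E) + z)}.
  exact: line_continuous.
have : \forall h \near (0 : C), (cmap c @` cdom c) (h *: (delta_mx 0 p : E) + z).
  by apply: zc; rewrite scale0r add0r; apply: open_nbhs_nbhs; split => //; exact: open_cimg.
move=> /(@nbhs_dnbhs _ _); apply: filterS => h ch /=.
rewrite pair_line scaler0 addr0.
by rewrite !jW_pth_zero// subrr scaler0.
Qed.

(** The correction term of the horizontal lift is linear in the second
    theta-derivatives of W, so the zero-section is horizontal. *)
Lemma jconn_zero_section (x : T) (a : E) : jconn J (j x) a = (a, 0).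
Proof.
have cx := cdom_chart_at M x.
have := @jconnE _ _ _ _ J (chart_at M x) (j x) a cx.
rewrite tvec_chart_at tb_cmap_zero_section (@tvec_chart_at _ _ _ X (j x)) => ->.
congr pair; apply/rowP => q; rewrite !mxE big1// => i _.
rewrite big1 ?mulr0// => p _.
by rewrite pth_pth_jW_zero ?mulr0//; exists x.
Qed.

Lemma Theta_I_zero_section (x : T) (u : E) : Theta_I J (j x) (u, 0) = 0.
Proof.
rewrite /Theta_I /Omega_I big1 ?oppr0 ?mulr0// => p _; rewrite big1// => q _.
by rewrite /wedge /dz /dth /= mxE !mulr0 subrr mulr0.
Qed.

Lemma Omega_I_zero_section (x : T) (u v : E) : Omega_I J (j x) (u, 0) (v, 0) = 0.
Proof.
rewrite /Omega_I big1 ?oppr0 ?mulr0// => p _; rewrite big1// => q _.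
by rewrite /wedge /dz /dth /= mxE !mulr0 subrr mulr0.
Qed.

Lemma Omega_minus_zero_section (x : T) (u v : E) :
  Omega_minus J (j x) (u, 0) (v, 0) = 0.
Proof.
rewrite /Omega_minus tb_cmap_zero_section; set c := chart_at M _.
have cx : (cmap c @` cdom c) (cmap c x) by exists x => //; exact: cdom_chart_at.
rewrite !big1 ?mulr0 ?addr0// => p _; rewrite big1// => q _.
- by rewrite pz_pth_jW_zero ?mul0r.
- by rewrite pth_pth_jW_zero ?mul0r.
- by rewrite /wedge /dth /= !mxE !mulr0 subrr mulr0.
Qed.

Lemma Omega_plus_zero_section (x : T) (u v : E) :
  Omega_plus J (j x) (u, 0) (v, 0) = jomega J x u v.
Proof.
have cx := cdom_chart_at M x.
by have := @jomegaE _ _ _ _ J _ x u v cx; rewrite !tvec_chart_at => ->.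
Qed.

Lemma symplectic_zero_section (Y : set (tbundle M)) (Z : topologicalType)
    (B : atlas E Z) (q : tbundle M -> Z) (Om : Z -> E -> E -> C) :
  twistor_fibre J 1 Y B q -> twistor_symplectic J 1 Y B q Om ->
  symplectic_map M B (j @^-1` Y) (q \o j) (jomega J) Om.
Proof.
move=> [[_ hq] _ _ _ _] [_ qOm]; split=> [|x Yx].
  by have := holo_map_comp (@holo_zero_section _ _ _ M) hq; rewrite setTI.
apply/funext => u; apply/funext => v; rewrite /pull2.
have Yjx : Y (j x) := Yx.
rewrite !(tmap_comp _ (I : setT x) Yjx (@holo_zero_section _ _ _ M) hq).
rewrite !tmap_zero_section -[LHS]/(pull2 X B q Om (j x) (u, 0) (v, 0)) qOm//.
by rewrite Omega_I_zero_section Omega_minus_zero_section Omega_plus_zero_section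
  expr1n mul1r mulr0 !addr0.
Qed.

(** Tangent vectors to the zero-section are horizontal, hence tangent to the
    leaves of im(h), and q kills them. *)
Lemma pull1_leaf_zero_section (Y : set (tbundle M)) (Z : topologicalType)
    (B : atlas E Z) (q : tbundle M -> Z) (N : set Z) (a : Z -> E -> C)
    (x : T) (u : E) :
  twistor_fibre J 0 Y B q -> form1_on B N a -> Y (j x) -> N (q (j x)) ->
  pull1 X B q a (j x) (u, 0) = 0.
Proof.
move=> [_ _ _ kerq _] ha Yx Nx; rewrite /pull1.
have -> : tmap X B q (j x) (u, 0) = 0.
  apply/(kerq _ Yx); exists u.
  by rewrite /jconn_eps scale0r addr0 jconn_zero_section.
have [+ _] := ha _ Nx => /(_ 1 0 0); rewrite scale1r addr0 mul1r => /eqP.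
by rewrite -subr_eq0 opprD addrA subrr add0r oppr_eq0 => /eqP.
Qed.

End JoyceZeroSection.

(** * The restricted tau-function *)

Theorem mainTheorem1 (R : realType) (n : nat) (T : topologicalType)
  (M : period_structure R n T) (J : joyce_structure M)
  (* the twistor fibres Z_1 and Z_infinity *)
  (Y1 Yoo : set (tbundle M)) (Z1 Zoo : topologicalType)
  (B1 : atlas 'rV[Cplx R]_n Z1) (Boo : atlas 'rV[Cplx R]_n Zoo)
  (q1 : tbundle M -> Z1) (qoo : tbundle M -> Zoo)
  (Om1 : Z1 -> 'rV[Cplx R]_n -> 'rV[Cplx R]_n -> Cplx R)
  (Omoo : Zoo -> 'rV[Cplx R]_n -> 'rV[Cplx R]_n -> Cplx R)
  (Eoo : Zoo -> 'rV[Cplx R]_n)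
  (hZ1 : twistor_fibre J 1 Y1 B1 q1)
  (hZoo : twistor_fibre J 0 Yoo Boo qoo)
  (hOm1 : twistor_symplectic J 1 Y1 B1 q1 Om1)
  (hOmoo : twistor_symplectic J 0 Yoo Boo qoo Omoo)
  (hEoo : forall p, Yoo p ->
    tmap (tb_atlas M) Boo qoo p (euler p) = Eoo (qoo p))
  (* the local symplectic potentials *)
  (N0 : set T) (N1 : set Z1) (Noo : set Zoo)
  (Th0 : T -> 'rV[Cplx R]_n -> Cplx R)
  (Th1 : Z1 -> 'rV[Cplx R]_n -> Cplx R)
  (Thoo : Zoo -> 'rV[Cplx R]_n -> Cplx R)
  (hTh0 : symplectic_potential M N0 Th0 (jomega J))
  (hTh1 : symplectic_potential B1 N1 Th1 Om1)
  (hThoo : symplectic_potential Boo Noo Thoo Omoo)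
  (hLTh0 : forall x, N0 x -> forall u,
    lie1 M (euler_base M) Th0 x u = 2 * Th0 x u)
  (hLThoo : forall z, Noo z -> forall u, lie1 Boo Eoo Thoo z u = 0)
  (* the tau-function, on a domain where all of these are defined *)
  (V : set (tbundle M)) (tau : tbundle M -> Cplx R)
  (hV : forall p, V p ->
    [/\ Y1 p, Yoo p, N0 (tbase p), N1 (q1 p) & Noo (qoo p)])
  (htau : tau_function J B1 Boo q1 qoo Th0 Th1 Thoo V tau) :
  let j := zero_section M in
  [/\ (* d log(tau|_M) = Theta_0 - j^* q_1^* Theta_1 *)
      forall x, V (j x) -> forall u,
        dlog M (tau \o j) x u =
        Th0 x u - pull1 M (tb_atlas M) j (pull1 (tb_atlas M) B1 q1 Th1) x u,
      (* q_1 o j is a symplectic map from M to Z_1 *)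
      symplectic_map M B1 (j @^-1` Y1) (q1 \o j) (jomega J) Om1 &
      (* every local branch k of log(tau|_M) is a generating function of it *)
      forall (S : set T) (k : T -> Cplx R),
        open S -> S `<=` j @^-1` V -> holo_fun M S k ->
        (forall x, S x -> cexp (k x) = tau (j x)) ->
        generating_function M B1 S (q1 \o j) Th0 Th1 k].
Proof.
move=> j; have [_ hTau _ dTau] := htau.
have hj : holo_map M (tb_atlas M) setT j := @holo_zero_section R n T M.
have [[_ hq1] _ _ _ _] := hZ1.
have dlogE : forall x, V (j x) -> forall u,
    dlog M (tau \o j) x u =
    Th0 x u - pull1 M (tb_atlas M) j (pull1 (tb_atlas M) B1 q1 Th1) x u.
  move=> x Vx u; have [Y1x Yoox _ _ Noox] := hV _ Vx.
  have := dTau _ Vx (u, 0); rewrite /dlog (dfun_comp _ (I : setT x) Vx hj hTau).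
  rewrite tmap_zero_section => ->.
  have [_ fThoo _] := hThoo.
  rewrite (pull1_leaf_zero_section u hZoo fThoo Yoox Noox) Theta_I_zero_section.
  by rewrite mulr0 !addr0 /pull1 tmap_tbase tmap_zero_section.
split => //; first exact: symplectic_zero_section.
move=> S k oS SV hk kE; split => // x Sx u.
have Vx := SV _ Sx; have [Y1x _ _ _ _] := hV _ Vx.
have fE : forall y, S y -> cexp (k y) = (tau \o j) y by exact: kE.
rewrite -(dlog_cexp u oS Sx hk fE) dlogE// /pull1.
by rewrite (tmap_comp _ (I : setT x) Y1x hj hq1).
Qed.
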